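(* Let $m\geq 2$ and $n\geq 2$ be integers, let $a_i$ be the residue of $n$ modulo $m$, so $n\equiv a_i\pmod m$, and suppose that $(n-m,a_i)=1$. If $n$ ramifies modulo $m$ (that is, $\mathcal{R}(m)=n$), then $\mathrm{ind}_m(n)\equiv 0\pmod{a_i}$ or $(\mathrm{ind}_m(n),a_i)=1$.
   Context: For a positive integer $k$, the residue of $n$ modulo $k$ means the least nonnegative residue, i.e. the integer $a\in\{0,1,\dots,k-1\}$ with $n\equiv a\pmod k$. The integer $n\geq 2$, with residue $a_i$ modulo $m$, is said to ramify modulo $m$, written $\mathcal{R}(m)=n$, if there exists a positive integer $r<m$ such that the residue $s$ of $n$ modulo $r$ satisfies $a_i+s=m$. If $n$ ramifies modulo $m$, the index of ramification of $n$ modulo $m$, denoted $\mathrm{ind}_m(n)$, is a value $r_j<m$ such that the residue $s_j$ of $n$ modulo $r_j$ satisfies $a_i+s_j=m$ (the assertion is for any such value $r_j$). Here $(u,v)$ denotes the greatest common divisor of $u$ and $v$. *)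

(* Defs.v *)
From mathcomp Require Import all_boot all_order all_algebra.

Set Implicit Arguments.
Unset Strict Implicit.
Unset Printing Implicit Defensive.

(* The guard [0 < r] matters: [n %% 0] is [n] in MathComp. *)
Definition ramification_index (m n r : nat) : Prop :=
  0 < r < m /\ n %% m + n %% r = m.

Definition ramifies (m n : nat) : Prop :=
  2 <= n /\ exists r : nat, ramification_index m n r.

(* Main.v *)
Require Import Defs.
From mathcomp Require Import all_boot all_order all_algebra.

(** Write [n = q r + s] with [s] the residue of [n] modulo [r].  Ramification
    says [m = a + s], so subtracting cancels [s]: [n - m = q r - a].  A common
    divisor of [r] and [a] therefore divides both [n - m] and [a], which are
    coprime: this gives the second alternative. *)

(** The subtraction has to take place in the integers, as [n < m] is possible. *)
Lemma ramification_index_subz (m n r : nat) :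
  ramification_index m n r ->
  (n%:Z - m%:Z = (n %/ r)%:Z * r%:Z - (n %% m)%:Z)%R.
Proof.
case=> _ m_eq.
have -> : (n%:Z = (n %/ r)%:Z * r%:Z + (n %% r)%:Z)%R.
  by rewrite -PoszM -PoszD -divn_eq.
have -> : (m%:Z = (n %% m)%:Z + (n %% r)%:Z)%R by rewrite -PoszD m_eq.
by rewrite GRing.opprD GRing.addrA GRing.addrAC GRing.addrK.
Qed.

Theorem theorem4p2 (m n a : nat) (hm : 2 <= m) (hn : 2 <= n)
    (ha : a = n %% m)
    (hcop : (gcdz (n%:Z - m%:Z) a%:Z = 1)%R)
    (hram : ramifies m n) (r : nat) (hr : ramification_index m n r) :
  r = 0 %[mod a] \/ gcdn r a = 1.
Proof.
right; apply/eqP; rewrite -dvdn1.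
suff: (gcdz r a %| gcdz (n%:Z - m%:Z)%R a)%Z by rewrite hcop.
rewrite dvdz_gcd dvdz_gcdr andbT (ramification_index_subz _ _ _ hr) -ha.
by rewrite GRing.rpredB ?dvdz_gcdr // dvdz_mull ?dvdz_gcdl.
Qed.
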